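(* Let $I\subset\mathbb{R}$ be a compact interval. There do not exist a homeomorphism $f: I\to I$ and a Borel probability measure $\mu$ on $I$ such that $f$ is pairwise sensitive with respect to $\mu$.
   Context: Pairwise sensitivity: a homeomorphism $f:X\to X$ of a compact metric space $(X,d)$ is pairwise sensitive with respect to a Borel probability measure $\mu$ on $X$ if there is $\delta>0$ such that for $\mu\otimes\mu$-a.e. $(x,y)\in X\times X$ there is $n\in\mathbb{Z}$ with $d(f^n(x),f^n(y))\geq\delta$. The measure $\mu$ is not assumed to be $f$-invariant. The interval $I$ carries its usual metric. *)

(* Defs.v *)
From HB Require Import structures.
From mathcomp Require Import all_boot all_order all_algebra.
From mathcomp Require Import all_classical all_reals all_analysis.
Set Implicit Arguments.
Unset Strict Implicit.
Unset Printing Implicit Defensive.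
Import Order.TTheory GRing.Theory Num.Theory.
Import numFieldNormedType.Exports.
Local Open Scope classical_set_scope.
Local Open Scope ring_scope.

(* Measurable types are pointed in the library, hence so are the metric spaces
   below. This excludes only the empty space, which carries no probability. *)
#[short(type="pointedMetricType")]
HB.structure Definition PointedMetric (R : numDomainType) :=
  { X of Metric R X & isPointed X }.

Definition borel (R : numDomainType) (X : pointedMetricType R) :=
  g_sigma_algebraType (@open X).

Record homeo (X : topologicalType) := Homeo {
  homeo_fun :> X -> X ;
  homeo_inv : X -> X ;
  homeo_funK : cancel homeo_fun homeo_inv ;
  homeo_invK : cancel homeo_inv homeo_fun ;
  homeo_continuous : continuous homeo_fun ;
  homeo_inv_continuous : continuous homeo_inv }.

(* [Negz m] is the integer [- (m + 1)]. *)
Definition iterz (X : topologicalType) (f : homeo X) (n : int) (x : X) : X :=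
  match n with
  | Posz m => iter m f x
  | Negz m => iter m.+1 (homeo_inv f) x
  end.

Definition pairwise_sensitive (R : realType) (X : pointedMetricType R)
    (f : homeo X) (mu : probability (borel X) R) : Prop :=
  exists2 delta : R, 0 < delta &
    {ae (mu \x mu)%E, forall xy, exists n : int,
      delta <= mdist (iterz f n xy.1) (iterz f n xy.2)}.

(* The set [a, b] as a space of its own; the proof of [a <= b] provides the
   point. Its topology is the library's topology on subtypes. *)
Definition cinterval (R : realType) (a b : R) of a <= b : Type :=
  `[a, b]%classic.

Section cinterval_metric.
Variables (R : realType) (a b : R) (ab : a <= b).
Local Notation I := (cinterval ab).

HB.instance Definition _ := PseudoMetric.copy I `[a, b]%classic.

Let cinterval_left : a \in `[a, b]%classic.
Proof. by rewrite inE /= in_itv /= lexx ab. Qed.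

HB.instance Definition _ := isPointed.Build I (SigSub cinterval_left).

Definition cinterval_dist (x y : I) : R := `|val x - val y|.

Let dist_ge0 x y : 0 <= cinterval_dist x y.
Proof. exact: normr_ge0. Qed.

Let dist_positivity x y : cinterval_dist x y = 0 -> x = y.
Proof.
by move=> /normr0_eq0/eqP; rewrite subr_eq0 => /eqP xy; exact: val_inj.
Qed.

Let ballE (x : I) d : ball x d = [set y | cinterval_dist x y < d].
Proof. by []. Qed.

HB.instance Definition _ :=
  PseudoMetric_isMetric.Build R I dist_ge0 dist_positivity ballE.

Lemma cinterval_compact : compact [set: I].
Proof.
move=> F FF _; pose G := fmap (val : I -> R) F.
have valI (x : I) : `[a, b]%classic (val x) by exact: set_mem (valP x).
have Gab : G `[a, b]%classic.
  by apply: (@filterS _ F _ setT); [move=> x _; exact: valI | exact: filterT].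
have [p [abp clp]] := @segment_compact R a b G (fmap_proper_filter _ FF) Gab.
exists (SigSub (mem_set abp)); split=> // A B FA [_ [[W oW <-] Wp] WB].
have GA : G (val @` A) by apply: (@filterS _ F _ A) => [x Ax|]; first by exists x.
have [_ [[x Ax <-] Wx]] := clp _ _ GA (open_nbhs_nbhs (conj oW Wp)).
by exists x; split=> //; exact: WB.
Qed.

End cinterval_metric.

(* Main.v *)
(* The square g = f^2 of the homeomorphism is increasing. A point that g moves
   has a neighbourhood whose images under all f^n stay close together, because
   its g-orbit is monotone and hence convergent; on the fixed points of g only
   the two maps id and f matter. So I is covered by countably many measurable
   sets, each contained either in the fixed set of g or in its complement, no
   pair of points of which is ever separated by delta. If A is such a set, A x A
   is null by sensitivity, hence A is null, and then so is I. *)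
Require Import Defs.
From mathcomp Require Import all_boot all_order all_algebra.
From mathcomp Require Import all_classical all_reals all_analysis.
From mathcomp Require Import lra.
Import Order.TTheory GRing.Theory Num.Theory.
Import numFieldNormedType.Exports.
Local Open Scope classical_set_scope.
Local Open Scope ring_scope.

Section orbits.
Set Implicit Arguments.
Unset Strict Implicit.
Variables (R : realType) (a b : R) (ab : a <= b).
Local Notation I := (cinterval ab).
Implicit Types (x y : I) (g h : I -> I).

(** * Coordinates and continuity on the interval *)

Definition coord x : R := val x.

Lemma coord_inj : injective coord.
Proof. exact: val_inj. Qed.

Lemma coord_itv x : coord x \in `[a, b].
Proof. exact: (set_mem (valP x)). Qed.

Lemma coord_continuous : continuous coord.
Proof. exact: initial_continuous. Qed.

Lemma cinterval_near_dist h x (e : R) : {for x, continuous h} -> 0 < e ->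
  \forall y \near x, `|coord (h x) - coord (h y)| < e.
Proof. by move=> hc e0; exact: (cvg_ball hc e0). Qed.

Lemma iter_continuous (T : topologicalType) (h : T -> T) n :
  continuous h -> continuous (iter n h).
Proof.
move=> hc; elim: n => [|n IHn] x; first exact: cvg_id.
exact: (continuous_comp (IHn x) (hc _)).
Qed.

(** A continuous injection of an interval is strictly monotone, and either kind of monotonicity,
    applied twice, preserves the order. *)
Lemma continuous_injective_sq_increasing h : continuous h -> injective h ->
  {homo h \o h : x y / coord x < coord y}.
Proof.
move=> hc hi.
(* [c] sends reals outside [[a, b]] to the default [point], so that [F] is a real function to which
   the monotonicity theorem applies; only its values on [[a, b]] matter. *)
pose c (t : R) : I := insubd (point : I) t.
have cK t : t \in `[a, b] -> coord (c t) = t.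
  by move=> tab; rewrite /coord /c insubdK // mem_setE.
have Kc x : c (coord x) = x by rewrite /coord /c valKd.
pose F t := coord (h (c t)).
have FE x : coord (h x) = F (coord x) by rewrite /F Kc.
have Fc : {within [set` `[a, b]], continuous F}.
  apply/subspace_continuousP => t tab; apply/cvgrPdist_lt => e e0.
  have /nbhs_ballP[d /= d0 dh] := cinterval_near_dist (hc (c t)) e0.
  rewrite near_withinE; apply: filterS (nbhsx_ballx t d d0) => s ts sab.
  by apply: dh; change (`|coord (c t) - coord (c s)| < d); rewrite !cK.
have Fi : {in `[a, b] &, injective F}.
  by move=> s t sab tab /coord_inj/hi/(congr1 coord); rewrite !cK.
have Fv x : F (coord x) \in `[a, b] by rewrite -FE; exact: coord_itv.
move=> x y xy; rewrite /= !FE.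
have [Fm|Fm] := itv_continuous_inj_mono Fc Fi.
  by apply: (Fm) => //; apply: Fm => //; exact: coord_itv.
by apply: (Fm) => //; apply: Fm => //; exact: coord_itv.
Qed.

(** * Orbits of increasing maps and their stability *)

Lemma iter_increasing g n : {homo g : x y / coord x < coord y} ->
  {homo iter n g : x y / coord x < coord y}.
Proof. by move=> gh x y xy; elim: n => //= n; exact: gh. Qed.

Lemma increasing_orbit_cvg g x : {homo g : x y / coord x < coord y} -> g x <> x ->
  cvgn (fun n => coord (iter n g x) : R).
Proof.
move=> gh gx.
have vI y : a <= coord y <= b by have := coord_itv y; rewrite in_itv.
have [xg|xg|/coord_inj xg] := ltgtP (coord x) (coord (g x)); last by case: gx.
- apply: nondecreasing_is_cvgn; last first.
    by exists b => _ [n _ <-]; case/andP: (vI (iter n g x)).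
  apply/nondecreasing_seqP => n; apply: ltW.
  by rewrite iterSr; exact: iter_increasing.
- apply: nonincreasing_is_cvgn; last first.
    by exists a => _ [n _ <-]; case/andP: (vI (iter n g x)).
  apply/nonincreasing_seqP => n; apply: ltW.
  by rewrite iterSr; exact: iter_increasing.
Qed.

(** Continuity controls finitely many iterates; later ones are trapped between two terms of the
    convergent orbit of [x], which are less than [e] apart. *)
Lemma increasing_stable_at_wandering g x (e : R) : continuous g ->
  {homo g : x y / coord x < coord y} -> g x <> x -> 0 < e ->
  \forall y \near x, forall n, `|coord (iter n g x) - coord (iter n g y)| < e.
Proof.
move=> gc gh gx e0.
have /cvg_ex[l /cvgrPdist_lt ul] := increasing_orbit_cvg gh gx.
have [|N _ uN] := ul (e / 2); first by lra.
have gap n : (N <= n)%N -> `|coord (iter n g x) - coord (iter n.+2 g x)| < e.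
  move=> Nn; have := uN n Nn; have := uN n.+2 (leq_trans Nn (leqW (leqnSn n))).
  by rewrite /= !ltr_norml; lra.
have near0 : \forall y \near x, forall i : 'I_N.+1,
    `|coord (iter i g x) - coord (iter i g y)| < e.
  apply: (@filter_forall _ _ (fun (i : 'I_N.+1) y =>
    `|coord (iter i g x) - coord (iter i g y)| < e) _ (nbhs_filter x)) => i.
  by apply: cinterval_near_dist e0; exact: iter_continuous.
(* With [y] near [x] and [g y] near [g x] to within this radius, [g y] stays on the same side of [x]
   as [g x], and [y] on the same side of [g x] as [x]. *)
have d0 : 0 < `|coord (g x) - coord x|.
  by rewrite normr_gt0 subr_eq0; apply/eqP => /coord_inj.
near=> y => n.
have [nN|Nn] := ltnP n N.+1.
  by have /(_ (Ordinal nN)) : forall i : 'I_N.+1,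
    `|coord (iter i g x) - coord (iter i g y)| < e by near: y.
(* Near x, both g^(n+1) x and g^(n+1) y lie between g^n x and g^(n+2) x. *)
case: n Nn => // n Nn.
have xy : `|coord x - coord y| < `|coord (g x) - coord x|.
  by near: y; exact: (cinterval_near_dist (h := id) (x := x) cvg_id d0).
have gxy : `|coord (g x) - coord (g y)| < `|coord (g x) - coord x|.
  by near: y; exact: cinterval_near_dist (gc x) d0.
have gi := @iter_increasing g n gh; have giS := @iter_increasing g n.+1 gh.
have {gap} := gap n Nn.
have [xg|xg|/coord_inj xg] := ltgtP (coord x) (coord (g x)); last by case: gx.
- have d := gtr0_norm (etrans (subr_gt0 _ _) xg).
  rewrite {}d !ltr_norml in xy gxy.
  have /gi : coord x < coord (g y) by lra.
  have /giS : coord y < coord (g x) by lra.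
  by have := gi _ _ xg; have := giS _ _ xg; rewrite -!iterSr !ltr_norml; lra.
- have d := ltr0_norm (etrans (subr_lt0 _ _) xg).
  rewrite {}d !ltr_norml in xy gxy.
  have /gi : coord (g y) < coord x by lra.
  have /giS : coord (g x) < coord y by lra.
  by have := gi _ _ xg; have := giS _ _ xg; rewrite -!iterSr !ltr_norml; lra.
Unshelve. all: by end_near. Qed.

(** The equivalence excludes moved points near a fixed point of [h \o h]: such points may drift
    away, for instance if that point is repelling. *)
Lemma sq_fixed_stable h x (e : R) : continuous h -> injective h -> 0 < e ->
  \forall y \near x, (h (h y) = y <-> h (h x) = x) ->
    forall n, `|coord (iter n h x) - coord (iter n h y)| < e.
Proof.
move=> hc hi e0; pose g := h \o h.
have gc : continuous g by move=> z; exact: continuous_comp (hc _) (hc _).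
have gh := continuous_injective_sq_increasing hc hi.
have iterE n z : iter n h z = iter n./2 g (iter (odd n) h z).
  have dbl m w : iter m.*2 h w = iter m g w by elim: m => //= m ->.
  by rewrite -{1}[n]odd_double_half addnC iterD dbl.
have nearh : \forall y \near x, forall r : bool,
    `|coord (iter r h x) - coord (iter r h y)| < e.
  apply: (@filter_forall _ _ (fun (r : bool) y =>
    `|coord (iter r h x) - coord (iter r h y)| < e) _ (nbhs_filter x)) => r.
  by apply: cinterval_near_dist e0; exact: iter_continuous.
have [gx|gx] := pselect (g x = x).
  have gfix z (r n : nat) : g z = z -> iter n g (iter r h z) = iter r h z.
    move=> gz; have gr : g (iter r h z) = iter r h z.
      by rewrite -[in RHS]gz /g /= -!iterSr.
    by elim: n => // n IHn; rewrite iterS IHn.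
  near=> y => -[_ /(_ gx) gy] n; rewrite (iterE n x) (iterE n y) !gfix //.
  move: (odd n); near: y; exact: nearh.
(* Odd iterates of [h] follow the [g]-orbit of [h x], so [h x] must be moved by [g] as well;
   continuity of [h] pulls its stable neighbourhood back to [x]. *)
have ghx : g (h x) <> h x by move=> /hi.
have hy : h @ x --> h x by exact: hc.
have s0 := increasing_stable_at_wandering gc gh gx e0.
have s1 := hy _ (increasing_stable_at_wandering gc gh ghx e0).
near=> y => _ n; rewrite (iterE n x) (iterE n y).
move: n./2 => m; case: (odd n) => /=.
  by move: m; near: y; exact: s1.
by move: m; near: y; exact: s0.
Unshelve. all: by end_near. Qed.

(** * Open sets for the cover, and two-sided orbits *)

Lemma open_not_fixed (T : metricType R) (g : T -> T) : continuous g ->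
  open [set x | g x <> x].
Proof.
move=> gc; rewrite openE => x /= gx.
have d0 : 0 < mdist (g x) x / 2.
  by rewrite divr_gt0 // mdist_gt0; apply/eqP.
have h1 := gc x _ (nbhsx_ballx (g x) _ d0).
have h2 := nbhsx_ballx x _ d0.
rewrite /interior; near=> y => gy.
have : ball (g x) (mdist (g x) x / 2) (g y) by near: y.
have : ball x (mdist (g x) x / 2) y by near: y.
rewrite gy => xy gxy.
by have := ball_splitl gxy xy; rewrite ballEmdist /= ltxx.
Unshelve. all: by end_near. Qed.

Lemma open_coord_itv (p q : R) : open [set x : I | p < coord x < q].
Proof.
apply: (@open_comp _ _ coord [set t | p < t < q]); last first.
  by rewrite -set_itvoo; exact: itv_open.
by move=> x _; exact: coord_continuous.
Qed.

Lemma homeo_stable (f : homeo I) x (e : R) : 0 < e ->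
  \forall y \near x, (f (f y) = y <-> f (f x) = x) ->
    forall n, `|coord (iterz f n x) - coord (iterz f n y)| < e.
Proof.
move=> e0.
(* The squares of [f] and of its inverse fix the same points, so one condition on [y] serves both
   time directions. *)
have sq_fixed_inv y : homeo_inv f (homeo_inv f y) = y <-> f (f y) = y.
  by split=> yE; rewrite -{1}yE ?homeo_funK ?homeo_invK.
have s1 := sq_fixed_stable x (@homeo_continuous _ f)
  (can_inj (@homeo_funK _ f)) e0.
have s2 := sq_fixed_stable x (@homeo_inv_continuous _ f)
  (can_inj (@homeo_invK _ f)) e0.
apply: filterS2 s1 s2 => y h1 h2 xy [n|n]; first exact: h1.
by apply: (h2 _ n.+1); rewrite !sq_fixed_inv.
Qed.

(** * Null sets and the countable cover *)

Lemma negligible_bigcup_countable (d : measure_display)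
    (T : measurableType d) (mu : {measure set T -> \bar R}) (C : countType)
    (D : set C) (F : C -> set T) :
  (forall i, D i -> mu.-negligible (F i)) ->
  mu.-negligible (\bigcup_(i in D) F i).
Proof.
move=> F0.
(* Reindexing by codes in [nat]: [G k] is a single [F i], or empty when no index in [D] has code
   [k]. *)
pose G k := \bigcup_(i in [set i | D i /\ pickle i = k]) F i.
apply: (@negligibleS _ _ _ _ (\bigcup_k G k)).
  by move=> x [i Di Fx]; exists (pickle i) => //; exists i.
apply: negligible_bigcup => k.
have [[i [Di ik]]|nD] := pselect (exists i, D i /\ pickle i = k).
  apply: negligibleS (F0 i Di) => x [j [_ jk]] Fx.
  by rewrite -(pcan_inj pickleK (etrans jk (esym ik))).
apply: negligibleS (negligible_set0 mu) => x [j Dj _].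
by apply: nD; exists j.
Qed.

(** The product measure of [A]*[A] is the square of [mu A]. *)
Lemma null_of_setX_subset (d : measure_display) (T : measurableType d)
    (mu : probability T R) (A : set T) (N : set (T * T)) :
  measurable A -> measurable N -> (mu \x mu)%E N = 0%E -> A `*` A `<=` N ->
  mu A = 0%E.
Proof.
move=> mA mN N0 AN.
have : ((mu \x mu) (A `*` A) = 0)%E.
  by apply: subset_measure0 AN N0 => //; exact: measurableX.
by rewrite product_measure1E // => /eqP; rewrite mule_eq0 orbb => /eqP.
Qed.

Lemma cinterval_not_pairwise_sensitive (f : homeo I)
  (mu : probability (borel I) R) : ~ pairwise_sensitive f mu.
Proof.
move=> [delta d0 [N [mN N0 sN]]].
have e0 : 0 < delta / 2 by rewrite divr_gt0.
pose moved : set (borel I) := [set y : I | f (f y) <> y].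
pose piece (s : bool) := if s then moved else ~` moved.
(* Rational endpoints keep the index type countable; the boolean keeps fixed and moved points of
   [f \o f] apart, as [homeo_stable] requires. *)
pose A (i : rat * rat * bool) : set (borel I) :=
  [set y : I | ratr i.1.1 < coord y < ratr i.1.2] `&` piece i.2.
have mA i : measurable (A i).
  apply: measurableI.
    by apply: sub_sigma_algebra; exact: open_coord_itv.
  have mF : measurable moved.
    apply: sub_sigma_algebra; apply: (@open_not_fixed I (f \o f)) => z.
    by apply: continuous_comp; exact: homeo_continuous.
  by case: i.2; [exact: mF | exact: measurableC].
pose good i := A i `*` A i `<=` N.
have cover x : exists2 i, good i & A i x.
  have /nbhs_ballP[r /= r0 xr] := homeo_stable f x e0.
  have [|p] := @rat_in_itvoo _ (coord x - r) (coord x).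
    by rewrite ltrBlDr ltrDl.
  have [|q] := @rat_in_itvoo _ (coord x) (coord x + r).
    by rewrite ltrDl.
  rewrite !in_itv /= => /andP[xq qr] /andP[rp px].
  have [s xs sE] : exists2 s : bool, piece s x &
      forall w, piece s w -> (f (f w) = w <-> f (f x) = x).
    have [xE|xE] := pselect (f (f x) = x).
      by exists false => [//|w /contrapT wE].
    by exists true => // w wE.
  exists (p, q, s); last by split=> //=; rewrite px xq.
  have near_x w n : A (p, q, s) w ->
      `|coord (iterz f n x) - coord (iterz f n w)| < delta / 2.
    move=> [/= /andP[pw wq] /sE wE]; apply: xr => //.
    by change (`|coord x - coord w| < r); rewrite ltr_norml; lra.
  (* [N] contains every pair that is never separated by [delta]. Both orbits stay within [delta / 2]
     of the orbit of [x], so the triangle inequality puts [(y, z)] in [N]. *)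
  move=> [y z] /= [Ay Az]; apply: sN => /= -[n].
  apply/negP; rewrite -ltNge.
  change (`|coord (iterz f n y) - coord (iterz f n z)| < delta).
  by have := near_x y n Ay; have := near_x z n Az; rewrite !ltr_norml; lra.
have : mu.-negligible [set: borel I].
  apply: (@negligibleS _ _ _ _ (\bigcup_(i in good) A i)).
    by move=> x _; have [i gi Ax] := cover x; exists i.
  apply: negligible_bigcup_countable => i gi; apply/negligibleP; first exact: mA.
  exact: null_of_setX_subset (mA i) mN N0 gi.
move=> /(negligibleP _ measurableT) mu0.
have : mu setT = 1%E by exact: probability_setT.
by rewrite [mu _]mu0 => /eqP; rewrite eq_sym onee_eq0.
Qed.

End orbits.

Theorem theorem2p9 (R : realType) (a b : R) (ab : a <= b) :
  ~ exists (f : homeo (cinterval ab))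
      (mu : probability (borel (cinterval ab)) R),
      pairwise_sensitive f mu.
Proof. by move=> [f [mu]]; exact: cinterval_not_pairwise_sensitive. Qed.
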